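(* Let $\bar Z\in\mathbb{R}^{C\times T\times m}$ be a collection of $m$ multi-channel signals $\bar z^1,\dots,\bar z^m\in\mathbb{R}^{C\times T}$, let $\alpha>0$, and for $j=1,\dots,k$ let $\alpha_j>0$, $\gamma_j\in\mathbb{R}$ and $\Pi^j$ be a nonnegative diagonal $m\times m$ matrix; set $\bar\Pi^j=\Pi^j\otimes I_T$. For each frequency $p\in\{0,\dots,T-1\}$ define $$\bar{\mathcal E}(p)=\alpha\big[I_C+\alpha\,\mathrm{DFT}(\bar Z)(p)\,\mathrm{DFT}(\bar Z)(p)^*\big]^{-1},\qquad \bar{\mathcal C}^j(p)=\alpha_j\big[I_C+\alpha_j\,\mathrm{DFT}(\bar Z)(p)\,\Pi^j\,\mathrm{DFT}(\bar Z)(p)^*\big]^{-1},$$ and $\bar U(p)=\bar{\mathcal E}(p)\,\mathrm{DFT}(\bar Z)(p)$, $\bar W^j(p)=\bar{\mathcal C}^j(p)\,\mathrm{DFT}(\bar Z)(p)$ (each in $\mathbb{C}^{C\times m}$), giving arrays $\bar U,\bar W^j\in\mathbb{C}^{C\times T\times m}$. Then the gradients with respect to the real array $\bar Z$ satisfy $$\frac{1}{2T}\frac{\partial\log\det\big(I+\alpha\,\mathsf{circ}(\bar Z)\mathsf{circ}(\bar Z)^*\big)}{\partial\bar Z}=\mathrm{IDFT}(\bar U),\qquad \frac{\gamma_j}{2T}\frac{\partial\log\det\big(I+\alpha_j\,\mathsf{circ}(\bar Z)\bar\Pi^j\mathsf{circ}(\bar Z)^*\big)}{\partial\bar Z}=\gamma_j\,\mathrm{IDFT}(\bar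 W^j\Pi^j),$$ where $\bar W^j\Pi^j$ denotes multiplying, at each frequency $p$, the $C\times m$ slice $\bar W^j(p)$ on the right by $\Pi^j$.
   Context: For $v\in\mathbb{R}^T$ (indices $t\in\{0,\dots,T-1\}$), $\mathsf{circ}(v)\in\mathbb{R}^{T\times T}$ has entries $v((a-b)\bmod T)$. For $\bar z\in\mathbb{R}^{C\times T}$ with channels $\bar z[c]\in\mathbb{R}^T$, $\mathsf{circ}(\bar z)\in\mathbb{R}^{CT\times T}$ stacks $\mathsf{circ}(\bar z[1]),\dots,\mathsf{circ}(\bar z[C])$ vertically, and $\mathsf{circ}(\bar Z)=[\mathsf{circ}(\bar z^1),\dots,\mathsf{circ}(\bar z^m)]\in\mathbb{R}^{CT\times Tm}$. DFT convention (applied along the time dimension, channel by channel and signal by signal): with $\omega=e^{-2\pi\sqrt{-1}/T}$, $\mathrm{DFT}(v)(p)=\sum_{t=0}^{T-1}v(t)\omega^{pt}$ and $\mathrm{IDFT}$ is its inverse, $\mathrm{IDFT}(u)(t)=\frac1T\sum_{p=0}^{T-1}u(p)\omega^{-pt}$. $\mathrm{DFT}(\bar Z)(p)\in\mathbb{C}^{C\times m}$ has $(c,i)$ entry $\mathrm{DFT}(\bar z^i[c])(p)$; for an array $\bar U\in\mathbb{C}^{C\times T\times m}$, $\bar U(p)$ is its $C\times m$ slice at frequency $p$. $^*$ is conjugate transpose; $\otimes$ is the Kronecker product. *)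

(* Defs.v *)
From mathcomp Require Import all_boot all_order all_algebra.
From mathcomp Require Import all_classical all_reals all_analysis.
From mathcomp Require Import complex.
Set Implicit Arguments. Unset Strict Implicit. Unset Printing Implicit Defensive.
Import Order.TTheory GRing.Theory Num.Theory.
Local Open Scope ring_scope.
Local Open Scope complex_scope.

Section Defs.
Variable R : realType.

Definition arr (C T m : nat) := 'I_C -> 'I_T -> 'I_m -> R.

Lemma ord_pos (T : nat) (a : 'I_T) : (0 < T)%N.
Proof. exact: leq_ltn_trans (leq0n a) (ltn_ord a). Qed.

Definition sub_mod (T : nat) (a b : 'I_T) : 'I_T :=
  Ordinal (ltn_pmod (a + (T - b))%N (ord_pos a)).

Definition circ (T : nat) (v : 'I_T -> R) : 'M[R]_T :=
  \matrix_(a < T, b < T) v (sub_mod a b).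

Definition circ_sig (C T : nat) (z : 'I_C -> 'I_T -> R) :
  'M[R]_(\sum_(c < C) T, T) := \mxcol_(c < C) circ (z c).

Definition circZ (C T m : nat) (Z : arr C T m) :
  'M[R]_(\sum_(c < C) T, \sum_(i < m) T) :=
  \mxrow_(i < m) circ_sig (fun c t => Z c t i).

Definition kron_id (m T : nat) (Pi : 'M[R]_m) :
  'M[R]_(\sum_(i < m) T) :=
  \mxblock_(i < m, j < m) (Pi i j *: (1%:M : 'M[R]_T)).

Definition omega (T : nat) : R[i] :=
  (cos (2 * pi / T%:R)) +i* (- sin (2 * pi / T%:R)).

Definition DFT (C T m : nat) (Z : arr C T m) (p : 'I_T) : 'M[R[i]]_(C, m) :=
  \matrix_(c < C, i < m)
     \sum_(t < T) (Z c t i)%:C * omega T ^+ (p * t).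

Definition IDFT (C T m : nat) (U : 'I_T -> 'M[R[i]]_(C, m))
  (c : 'I_C) (t : 'I_T) (i : 'I_m) : R[i] :=
  (T%:R)^-1 * \sum_(p < T) U p c i * (omega T ^+ (p * t))^-1.

Definition ctrmx (n1 n2 : nat) (A : 'M[R[i]]_(n1, n2)) : 'M[R[i]]_(n2, n1) :=
  map_mx conjc A^T.

Definition cmx (n1 n2 : nat) (A : 'M[R]_(n1, n2)) : 'M[R[i]]_(n1, n2) :=
  map_mx (fun x => x%:C) A.

Definition Ebar (C T m : nat) (alpha : R) (Z : arr C T m) (p : 'I_T) :
  'M[R[i]]_C :=
  alpha%:C *: invmx (1%:M + alpha%:C *: (DFT Z p *m ctrmx (DFT Z p))).

Definition Cbar (C T m : nat) (alpha : R) (Pi : 'M[R]_m) (Z : arr C T m)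
  (p : 'I_T) : 'M[R[i]]_C :=
  alpha%:C *: invmx (1%:M + alpha%:C *: (DFT Z p *m cmx Pi *m ctrmx (DFT Z p))).

Definition perturb (C T m : nat) (Z : arr C T m) (c : 'I_C) (t : 'I_T)
  (i : 'I_m) (s : R) : arr C T m :=
  fun c' t' i' => Z c' t' i' + (if (c' == c) && (t' == t) && (i' == i)
                                then s else 0).

(* log det (I + alpha circ(Z) circ(Z)^* ) (circ(Z) is real, so ^* = ^T) *)
Definition logdet_E (C T m : nat) (alpha : R) (Z : arr C T m) : R :=
  ln (\det (1%:M + alpha *: (circZ Z *m (circZ Z)^T))).

Definition logdet_C (C T m : nat) (alpha : R) (Pi : 'M[R]_m) (Z : arr C T m) : R :=
  ln (\det (1%:M + alpha *: (circZ Z *m kron_id T Pi *m (circZ Z)^T))).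

End Defs.

(* Main.v *)
(* Write M = circ(Z), P = Pi (x) I_T and G = I + a M P M^T. With
   phi_p(b) = omega^(-p b), the matrices Phi_p = I (x) phi_p intertwine all the
   circulant blocks with their symbols: M Phi_p = Phi_p D_p and
   M^T Phi_p = Phi_p D_p^*, where D_p = DFT(Z)(p). Hence G Phi_p = Phi_p K_p with
   K_p = I + a D_p Pi D_p^*, and since sum_p Phi_p Phi_p^* = T I, the real matrix
   a G^-1 M P is the block circulant matrix of IDFT(W Pi). By Jacobi's formula
   and the symmetry of G, the derivative of log det G in the direction E is
   2 tr(a G^-1 M P E^T); for E = circ of a unit array this picks T equal entries
   of that block circulant matrix. The first formula is the case Pi = I. *)
Require Import Defs.
From mathcomp Require Import all_boot all_order all_algebra.
From mathcomp Require Import all_classical all_reals all_analysis.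
From mathcomp Require Import perm complex ring lra.
Set Implicit Arguments. Unset Strict Implicit. Unset Printing Implicit Defensive.
Import Order.TTheory GRing.Theory Num.Theory.
Local Open Scope ring_scope.
Local Open Scope complex_scope.

(** * Derivative of log det *)

(** Leibniz rule; [uniq] ensures that [i == k] singles out exactly one factor. *)
Lemma deriv_prod_uniq (R : comNzRingType) (I : eqType) (r : seq I)
    (F : I -> {poly R}) : uniq r ->
  (\prod_(i <- r) F i)^`() =
  \sum_(k <- r) \prod_(i <- r) (if i == k then (F i)^`() else F i).
Proof.
elim: r => [|x r IHr] /=; first by rewrite !big_nil derivC.
move=> /andP[xr ur]; rewrite !big_cons derivM IHr// eqxx; congr (_ * _ + _).
  apply: eq_big_seq => i ir; case: eqP => // eix.
  by rewrite eix in ir; rewrite ir in xr.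
rewrite big_distrr /=; apply: eq_big_seq => k kr; rewrite big_cons.
by case: eqP => // exk; rewrite exk kr in xr.
Qed.

(** Jacobi's formula: the Leibniz rule on each permutation product gives the sum of the determinants
    in which one row is differentiated, and each is expanded along that row. *)
Lemma deriv_det (R : comNzRingType) (n : nat) (A : 'M[{poly R}]_n) :
  (\det A)^`() = \sum_i \sum_j (A i j)^`() * cofactor A i j.
Proof.
pose B k := \matrix_(i, j) (if i == k then (A i j)^`() else A i j).
transitivity (\sum_k \det (B k)).
  rewrite /determinant raddf_sum exchange_big /=; apply: eq_bigr => s _.
  rewrite -big_distrr /=.
  transitivity ((-1) ^+ odd_perm s * (\prod_i A i (s i))^`()).
    by case: (odd_perm s); rewrite ?expr0 ?expr1 ?mul1r ?mulN1r ?derivN.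
  congr (_ * _).
  rewrite deriv_prod_uniq ?index_enum_uniq//; apply: eq_bigr => k _.
  by apply: eq_bigr => i _; rewrite mxE.
apply: eq_bigr => k _; rewrite (expand_det_row _ k); apply: eq_bigr => j _.
rewrite mxE eqxx; congr (_ * (_ * \det _)).
(* The minors agree because row k, the only one where [B k] differs from [A], is deleted. *)
apply/matrixP => a b; rewrite !mxE.
by rewrite eq_sym (negPf (neq_lift _ _)).
Qed.

(** [Q] is the second-order term that appears when M moves to M + s E. The determinant is a
    polynomial in s, so its derivative is algebraic and [ln] enters only through the chain rule. *)
Lemma is_derive_ln_det (R : realType) (n : nat) (G B Q : 'M[R]_n) :
  0 < \det G ->
  is_derive (0 : R) 1 (fun s : R => ln (\det (G + s *: B + s ^+ 2 *: Q)))
    (\tr (B *m invmx G)).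
Proof.
move=> G0.
pose A : 'M[{poly R}]_n :=
  map_mx polyC G + 'X *: map_mx polyC B + 'X^2 *: map_mx polyC Q.
have evA s : map_mx (horner_eval s) A = G + s *: B + s ^+ 2 *: Q.
  by apply/matrixP => i j; rewrite !mxE /horner_eval !hornerE.
have A0 : map_mx (horner_eval 0) A = G.
  by rewrite evA expr0n /= !scale0r !addr0.
have -> : (fun s : R => ln (\det (G + s *: B + s ^+ 2 *: Q))) =
          (@ln R) \o horner (\det A).
  by apply/funext => s /=; rewrite -evA det_map_mx.
have dA0 : (\det A).[0] = \det G by rewrite -A0 det_map_mx.
have D1 : is_derive (0 : R) 1 (horner (\det A)) (\det A)^`().[0].
  exact: is_derive_poly.
have D2 : is_derive ((\det A).[0] : R) 1 (@ln R) (\det A).[0]^-1.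
  by apply: is_derive1_ln; rewrite dA0.
apply: (is_derive_eq (is_derive1_comp D2 D1)).
rewrite dA0 deriv_det horner_sum.
have -> : \sum_i (\sum_j (A i j)^`() * cofactor A i j).[0] = \tr (B *m \adj G).
  apply: eq_bigr => i _; rewrite horner_sum mxE; apply: eq_bigr => j _.
  rewrite hornerM [in RHS]mxE; congr (_ * _).
    rewrite !mxE !derivD !derivM !derivC !derivX.
    by rewrite !hornerE /= !addr0.
  by rewrite -[LHS]/(horner_eval 0 _) -cofactor_map_mx A0.
have uG : G \in unitmx by rewrite unitmxE unitfE gt_eqF.
by rewrite /invmx uG -scalemxAr mxtraceZ.
Qed.

(** * Positivity of the determinant *)

(* The determinant is a polynomial in s, equal to 1 at s = 0, without root in
   [0, 1]. *)
Lemma det_pos_of_unit (R : rcfType) (n : nat) (B : 'M[R]_n) :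
  (forall s, 0 <= s <= 1 -> 1%:M + s *: B \in unitmx) ->
  0 < \det (1%:M + B).
Proof.
move=> uB.
pose q : {poly R} := \det (1%:M + 'X *: map_mx polyC B).
have qE s : q.[s] = \det (1%:M + s *: B).
  rewrite -[LHS]/(horner_eval s _) -det_map_mx; congr (\det _).
  by apply/matrixP => i j; rewrite !mxE /= /horner_eval
    hornerD hornerMn hornerM !hornerE.
rewrite -[B in _ + B]scale1r -qE ltNge; apply/negP => q1.
(* The sign change is needed because [poly_ivt] expects a nonpositive value at the left end, while
   q(0) = 1. *)
have [] := @poly_ivt R (- q) 0 1 ler01.
  by rewrite !hornerN !oppr_cp0 q1 qE scale0r addr0 det1 ler01.
move=> s s01; rewrite rootN /root qE => /eqP ds.
by have := uB s s01; rewrite unitmxE unitfE ds eqxx.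
Qed.

(** If x (I + s M D M^T) = 0, pairing with x gives |x|^2 + s sum_j d_j (x M)_j^2 = 0; both terms are
    nonnegative, so x = 0. *)
Lemma det_gram_gt0 (R : rcfType) (n l : nat) (M : 'M[R]_(n, l))
    (d : 'rV[R]_l) :
  (forall i, 0 <= d 0 i) -> 0 < \det (1%:M + M *m diag_mx d *m M^T).
Proof.
move=> d0; apply: det_pos_of_unit => s /andP[s0 _].
rewrite -row_free_unit -kermx_eq0; apply/eqP/row_matrixP => i; rewrite row0.
set x := row i _.
have : x *m (1%:M + s *: (M *m diag_mx d *m M^T)) = 0.
  by rewrite -row_mul mulmx_ker row0.
move/(congr1 (mulmxr x^T)); rewrite /= mul0mx mulmxDr mulmx1 mulmxDl.
have sq k (y : 'rV[R]_k) (e : 'rV[R]_k) :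
    (y *m diag_mx e *m y^T) 0 0 = \sum_j e 0 j * y 0 j ^+ 2.
  rewrite mul_mx_diag mxE; apply: eq_bigr => j _; rewrite !mxE.
  by rewrite mulrAC mulrC expr2.
have sq1 : (x *m x^T) 0 0 = \sum_j x 0 j ^+ 2.
  by rewrite mxE; apply: eq_bigr => j _; rewrite [x^T _ _]mxE expr2.
move/(congr1 (fun A : 'M[R]_1 => A 0 0)); rewrite mxE sq1.
rewrite -scalemxAr -scalemxAl [in X in _ + X]mxE.
have -> : x *m (M *m diag_mx d *m M^T) *m x^T =
          (x *m M) *m diag_mx d *m (x *m M)^T.
  by rewrite trmx_mul !mulmxA.
rewrite sq [in RHS]mxE => /eqP.
rewrite paddr_eq0 ?sumr_ge0//; last 2 first.
- by move=> j _; rewrite sqr_ge0.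
- by rewrite mulr_ge0// sumr_ge0// => j _; rewrite mulr_ge0 ?sqr_ge0.
case/andP => /eqP x0 _; apply/rowP => j; rewrite [RHS]mxE.
have sq_ge0 k : true -> 0 <= x 0 k ^+ 2 by rewrite sqr_ge0.
have /eqP : x 0 j ^+ 2 = 0 by exact: (psumr_eq0P sq_ge0 x0).
by rewrite sqrf_eq0 => /eqP.
Qed.

(** * Roots of unity and Fourier orthogonality *)

Section Fourier.
Variables (R : realType) (T : nat).
Hypothesis T0 : (0 < T)%N.
Local Notation w := (omega R T).

Lemma omegaX (n : nat) :
  w ^+ n = cos ((2 * pi / T%:R) * n%:R) +i* (- sin ((2 * pi / T%:R) * n%:R)).
Proof.
elim: n => [|n IHn]; first by rewrite mulr0 cos0 sin0 oppr0.
set x := 2 * pi / T%:R in IHn *.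
have -> : x * n.+1%:R = x * n%:R + x by rewrite -natr1 mulrDr mulr1.
rewrite exprS IHn /omega cosD sinD -/x.
by apply/eqP; rewrite eq_complex /=; apply/andP; split; apply/eqP; ring.
Qed.

Lemma omega_conj : conjc w = w^-1.
Proof.
have w1 : conjc w * w = 1.
  apply/eqP; rewrite /omega eq_complex /=; apply/andP; split; apply/eqP.
    by rewrite opprK mulrN opprK -!expr2 cos2Dsin2.
  by rewrite opprK; ring.
have w0 : w != 0.
  by apply: contraPneq w1 => ->; apply/eqP; rewrite mulr0 eq_sym oner_eq0.
by apply: (mulIf w0); rewrite w1 mulVf.
Qed.

Lemma omega_neq0 : w != 0.
Proof.
apply/eqP => w0; have := omegaX T; rewrite w0 expr0n eqn0Ngt T0 /=.
have TR : T%:R != 0 :> R by rewrite pnatr_eq0 -lt0n.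
rewrite divfK// mulrC mulr_natr.
rewrite -[pi *+ 2]add0r cosD2pi cos0 => -[] /eqP.
by rewrite eq_sym oner_eq0.
Qed.

Lemma omega_prim : T.-primitive_root w.
Proof.
have TR : T%:R != 0 :> R by rewrite pnatr_eq0 -lt0n.
have wT : w ^+ T = 1.
  rewrite omegaX divfK// mulrC mulr_natr.
  by rewrite -[pi *+ 2]add0r cosD2pi sinD2pi cos0 sin0 oppr0.
have [n prn dvn] := prim_order_exists T0 wT.
suff TN : T = n by rewrite -TN in prn.
apply/eqP; rewrite eqn_leq (dvdn_leq T0 dvn) andbT leqNgt; apply/negP => nT.
have n0 := prim_order_gt0 prn.
(* For an order n < T, the real part of w^n = 1 reads cos(2 x) = 1 with x = pi n / T in (0, pi),
   which forces sin x = 0, impossible there. *)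
have := prim_expr_order prn; rewrite omegaX => -[] c1 _.
pose x : R := pi * n%:R / T%:R.
have xE : 2 * pi / T%:R * n%:R = x *+ 2 by rewrite /x -mulr_natl; ring.
have /sin_gt0_pi : 0 < x < pi.
  rewrite /x !mulr_gt0 ?pi_gt0 ?invr_gt0 ?ltr0n//= ltr_pdivrMr ?ltr0n//.
  by rewrite ltr_pM2l ?pi_gt0// ltr_nat.
move: c1; rewrite xE cos_mulr2n cos2sin2 => c1.
have /eqP : sin x ^+ 2 = 0 by lra.
by rewrite sqrf_eq0 => /eqP ->; rewrite ltxx.
Qed.

(** Geometric sum of ratio z = w^b / w^a: z^T = 1 always, and primitivity gives z != 1 when a and b
    differ. *)
Lemma omega_orth (a b : 'I_T) :
  \sum_(p < T) (w ^+ (p * a))^-1 * w ^+ (p * b) = T%:R *+ (a == b).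
Proof.
pose z := w ^+ b / w ^+ a.
have zE (p : nat) : (w ^+ (p * a))^-1 * w ^+ (p * b) = z ^+ p.
  by rewrite /z expr_div_n -!exprM mulrC ![(p * _)%N]mulnC.
under eq_bigr do rewrite zE.
have [ab|ab] := eqVneq a b.
  rewrite /z ab divff ?expf_neq0 ?omega_neq0//.
  by under eq_bigr do rewrite expr1n; rewrite sumr_const card_ord.
have z1 : z != 1.
  rewrite -subr_eq0 /z -(mulrI_eq0 _ (mulfI (expf_neq0 a omega_neq0))).
  rewrite mulrBr mulr1 mulrCA divff ?expf_neq0 ?omega_neq0// mulr1 subr_eq0.
  rewrite (eq_prim_root_expr omega_prim) /= !modn_small// eq_sym.
  exact: ab.
apply/eqP; rewrite -(mulrI_eq0 _ (mulfI (_ : z - 1 != 0))) ?subr_eq0//.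
rewrite -subrX1 /z expr_div_n !(exprAC _ _ T).
by rewrite (prim_expr_order omega_prim) !expr1n divr1 subrr.
Qed.

Lemma omegaX_sub (p a b : 'I_T) :
  w ^+ (p * sub_mod a b) = w ^+ (p * a) / w ^+ (p * b).
Proof.
apply: (mulIf (expf_neq0 (p * b)%N omega_neq0)).
rewrite divfK ?expf_neq0 ?omega_neq0// -exprD.
apply/eqP; rewrite (eq_prim_root_expr omega_prim) -mulnDr /=.
by rewrite -modnMmr modnDml -addnA subnK 1?ltnW// modnDr modnMmr.
Qed.

(** Injectivity in either argument makes [sub_mod] a permutation of the times, so that sums can be
    reindexed by the lag a - b. *)
Lemma sub_mod_injl (b : 'I_T) : injective (fun a => sub_mod a b).
Proof.
move=> a a' /(congr1 val) /= /eqP.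
rewrite eqn_modDr !modn_small// => /eqP; exact: val_inj.
Qed.

Lemma sub_mod_injr (a : 'I_T) : injective (sub_mod a).
Proof.
move=> b b' /(congr1 val) /= /eqP; rewrite eqn_modDl => /eqP bb.
apply: val_inj => /=.
(* Adding b + b' to both sides absorbs the truncated subtractions. *)
have : (T - b + (b + b') = T - b' + (b + b') %[mod T])%N.
  by apply/eqP; rewrite eqn_modDr; apply/eqP.
rewrite addnA subnK 1?ltnW// [(b + b')%N]addnC addnA subnK 1?ltnW//.
by rewrite !modnDl !modn_small.
Qed.
End Fourier.

(** * Block circulant matrices in the Fourier basis *)

Section BlockFourier.
Variables (R : realType) (T : nat).
Hypothesis T0 : (0 < T)%N.
Local Notation w := (omega R T).

(** Coordinates of a flat index of a block matrix: the block number and the time inside the block.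
    All blocks have size T, so the time has a type that does not depend on the block. *)
Definition blk n (s : 'I_(\sum_(c < n) T)) : 'I_n := tagnat.sig1 s.
Definition pos n (s : 'I_(\sum_(c < n) T)) : 'I_T := tagnat.sig2 s.

Lemma eq_blk_pos n (s u : 'I_(\sum_(c < n) T)) :
  (s == u) = (blk s == blk u) && (pos s == pos u).
Proof.
apply/idP/idP => [/eqP -> | ]; first by rewrite !eqxx.
case/andP => /eqP b /eqP p.
rewrite -(tagnat.sig2K s) -(tagnat.sig2K u) -val_eqE tagnat.eq_Rank.
by rewrite -/(blk s) -/(blk u) b eqxx; apply/eqP/(congr1 val p).
Qed.

Lemma sum_blk_pos (V : nmodType) n (F : 'I_n -> 'I_T -> V) :
  \sum_s F (blk s) (pos s) = \sum_c \sum_a F c a.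
Proof.
rewrite (sig_big_dep (fun _ => true) (fun _ _ => true) F) /=.
rewrite (reindex (@tagnat.sig n (fun=> T))) //=.
exact: onW_bij (@tagnat.sig_bij n (fun=> T)).
Qed.

Lemma sum_deltal (V : pzRingType) n (c : 'I_n) (x : V) (F : 'I_n -> V) :
  \sum_k (x *+ (c == k)) * F k = x * F c.
Proof.
rewrite (bigD1 c)//= eqxx big1 ?addr0// => k /negPf kc.
by rewrite eq_sym kc mul0r.
Qed.

Lemma sum_deltar (V : pzRingType) n (c : 'I_n) (G F : 'I_n -> V) :
  \sum_k F k * (G k *+ (k == c)) = F c * G c.
Proof.
rewrite (bigD1 c)//= eqxx big1 ?addr0// => k /negPf kc.
by rewrite kc mulr0.
Qed.

Lemma circZE C m (Z : arr R C T m) s u :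
  circZ Z s u = Z (blk s) (sub_mod (pos s) (pos u)) (blk u).
Proof. by rewrite !mxE. Qed.

Lemma kron_idE m (P : 'M[R]_m) s u :
  kron_id T P s u = P (blk s) (blk u) *+ (pos s == pos u).
Proof. by rewrite !mxE mulr_natr. Qed.

(** The vectors omega^(-p b) are common eigenvectors of all circulant matrices of size T; here there
    is one copy for each of the n channels or signals. *)
Definition phi n (p : 'I_T) : 'M[R[i]]_(\sum_(c < n) T, n) :=
  \matrix_(s, c) ((w ^+ (p * pos s))^-1 *+ (blk s == c)).

Lemma cmxE n l (A : 'M[R]_(n, l)) : cmx A = map_mx (real_complex R) A.
Proof. by []. Qed.

Lemma conjc_sum (I : finType) (F : I -> R[i]) :
  conjc (\sum_j F j) = \sum_j conjc (F j).
Proof. exact: rmorph_sum. Qed.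

Lemma conjcZ (x : R) (y : R[i]) : conjc (x%:C * y) = x%:C * conjc y.
Proof. by rewrite -[in RHS](conjc_real x); exact: rmorphM. Qed.

Lemma conjcMn (x : R[i]) k : conjc (x *+ k) = conjc x *+ k.
Proof. exact: rmorphMn. Qed.

Lemma conj_omegaX k : conjc (w ^+ k) = (w ^+ k)^-1.
Proof. by rewrite -exprVn -(omega_conj R T); exact: rmorphXn. Qed.

Lemma conj_omegaXV k : conjc (w ^+ k)^-1 = w ^+ k.
Proof. by rewrite -conj_omegaX conjcK. Qed.

(** Taking the lag d = a - b as summation variable factors out omega^(-p a) and leaves the DFT
    sum. *)
Lemma circZ_phi C m (Z : arr R C T m) p :
  cmx (circZ Z) *m phi m p = phi C p *m DFT Z p.
Proof.
apply/matrixP => s i; rewrite !mxE.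
under eq_bigr do rewrite [cmx _ _ _]mxE circZE mxE.
under [RHS]eq_bigr do rewrite mxE.
rewrite sum_deltal mxE big_distrr /=.
rewrite (sum_blk_pos (fun j b => (Z (blk s) (sub_mod (pos s) b) j)%:C *
   ((w ^+ (p * b))^-1 *+ (j == i)))) exchange_big /=.
rewrite [RHS](reindex_inj (sub_mod_injr (a := pos s))) /=.
apply: eq_bigr => b _; rewrite sum_deltar omegaX_sub// mulrCA; congr (_ * _).
by rewrite mulKf ?expf_neq0 ?omega_neq0.
Qed.

(** As Z is real, conjugating its DFT only inverts the powers of omega, which is what the transposed
    circulants produce. *)
Lemma trcircZ_phi C m (Z : arr R C T m) p :
  cmx (circZ Z)^T *m phi C p = phi m p *m ctrmx (DFT Z p).
Proof.
apply/matrixP => u c; rewrite !mxE.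
under eq_bigr do rewrite [cmx _ _ _]mxE [_^T _ _]mxE circZE mxE.
under [RHS]eq_bigr do rewrite mxE.
rewrite sum_deltal !mxE conjc_sum big_distrr /=.
rewrite (sum_blk_pos (fun j a => (Z j (sub_mod a (pos u)) (blk u))%:C *
   ((w ^+ (p * a))^-1 *+ (j == c)))) exchange_big /=.
rewrite [RHS](reindex_inj (sub_mod_injl (b := pos u))) /=.
apply: eq_bigr => a _; rewrite sum_deltar conjcZ conj_omegaX.
rewrite mulrCA omegaX_sub// invf_div mulKf//.
by rewrite expf_neq0 ?omega_neq0.
Qed.

Lemma kron_id_phi m (P : 'M[R]_m) p :
  cmx (kron_id T P) *m phi m p = phi m p *m cmx P.
Proof.
apply/matrixP => u i; rewrite !mxE.
under eq_bigr do rewrite [cmx _ _ _]mxE kron_idE mxE.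
under [RHS]eq_bigr do rewrite mxE.
rewrite sum_deltal mxE.
rewrite (sum_blk_pos (fun j b => (P (blk u) j *+ (pos u == b))%:C *
   ((w ^+ (p * b))^-1 *+ (j == i)))) exchange_big /=.
under eq_bigr do rewrite sum_deltar rmorphMn /=.
by rewrite sum_deltal mulrC.
Qed.

Lemma phi_isometry n p : ctrmx (phi n p) *m phi n p = T%:R%:M.
Proof.
apply/matrixP => c d; rewrite !mxE.
under eq_bigr do rewrite !mxE.
rewrite (sum_blk_pos (fun j a => conjc ((w ^+ (p * a))^-1 *+ (j == c)) *
   ((w ^+ (p * a))^-1 *+ (j == d)))) exchange_big /=.
under eq_bigr => a _.
  rewrite sum_deltar conjcMn conj_omegaXV mulrnAl.
  rewrite divff ?expf_neq0 ?omega_neq0//.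
  over.
by rewrite sumr_const card_ord -mulrnA mulnC mulrnA eq_sym.
Qed.

Lemma phi_complete n : \sum_p phi n p *m ctrmx (phi n p) = T%:R%:M.
Proof.
apply/matrixP => s u; rewrite summxE !mxE eq_blk_pos.
under eq_bigr => p _.
  rewrite mxE.
  under eq_bigr do rewrite !mxE.
  rewrite sum_deltal conjcMn conj_omegaXV mulrnAr.
  over.
by rewrite sumrMnl omega_orth// -mulrnA mulnb andbC [blk u == _]eq_sym.
Qed.

(** * The resolvent as a block circulant matrix *)

Section Resolvent.
Variables (C m : nat) (Z : arr R C T m) (a : R) (P : 'M[R]_m).
Let M := circZ Z.
Let G := 1%:M + a *: (M *m kron_id T P *m M^T).
Hypothesis uG : G \in unitmx.

Let K p := 1%:M + a%:C *: (DFT Z p *m cmx P *m ctrmx (DFT Z p)).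

Let G_phi p : cmx G *m phi C p = phi C p *m K p.
Proof.
rewrite cmxE map_mxD map_mx1 map_mxZ !map_mxM -!cmxE mulmxDl mul1mx.
rewrite -scalemxAl -!mulmxA trcircZ_phi (mulmxA (cmx (kron_id _ _))).
rewrite kron_id_phi -(mulmxA (phi _ _)) (mulmxA (cmx M)) circZ_phi.
by rewrite mulmxDr mulmx1 -scalemxAr !mulmxA.
Qed.

(* Phi_p is injective and G invertible, so T^-1 Phi_p^* G^-1 Phi_p is a left
   inverse of K_p. *)
Let K_unit p : K p \in unitmx.
Proof.
have TC : (T%:R : R[i]) != 0 by rewrite pnatr_eq0 -lt0n.
have : (T%:R^-1 *: (ctrmx (phi C p) *m cmx (invmx G) *m phi C p)) *m K p = 1%:M.
  rewrite -scalemxAl -!mulmxA -G_phi (mulmxA (cmx (invmx G))).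
  rewrite !cmxE -map_mxM mulVmx// map_mx1 mul1mx phi_isometry.
  by rewrite scale_scalar_mx mulVf.
by case/mulmx1_unit.
Qed.

(** Inserting K_p K_p^-1 on the right turns Phi_p K_p into G Phi_p, and G^-1 cancels. *)
Let invG_phi p : cmx (invmx G) *m phi C p = phi C p *m invmx (K p).
Proof.
rewrite -[LHS]mulmx1 -(mulmxV (K_unit p)) mulmxA -(mulmxA _ (phi C p)) -G_phi.
by rewrite (mulmxA _ (cmx G)) !cmxE -map_mxM mulVmx// map_mx1 mul1mx.
Qed.

Lemma resolvent_circZE s u :
  ((a *: (invmx G *m M *m kron_id T P)) s u)%:C =
  IDFT (fun p => Cbar a P Z p *m DFT Z p *m cmx P)
    (blk s) (sub_mod (pos s) (pos u)) (blk u).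
Proof.
have TC : (T%:R : R[i]) != 0 by rewrite pnatr_eq0 -lt0n.
set Q := a *: _.
(* Completeness of the Phi_p is inserted on the right of Q, which is then pushed through each
   Phi_p. *)
have QE : cmx Q = T%:R^-1 *:
    \sum_p phi C p *m (Cbar a P Z p *m DFT Z p *m cmx P) *m ctrmx (phi m p).
  have -> : cmx Q = T%:R^-1 *: (cmx Q *m \sum_p phi m p *m ctrmx (phi m p)).
    by rewrite phi_complete mul_mx_scalar scalerA mulVf// scale1r.
  rewrite mulmx_sumr; congr (_ *: _); apply: eq_bigr => p _.
  rewrite mulmxA; congr (_ *m _).
  rewrite cmxE map_mxZ !map_mxM -!cmxE -scalemxAl -mulmxA kron_id_phi.
  rewrite !mulmxA -(mulmxA _ _ (phi m p)) circZ_phi mulmxA invG_phi.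
  by rewrite /Cbar -/(K p) -scalemxAr -!scalemxAl.
transitivity (cmx Q s u); first by rewrite [RHS]mxE.
rewrite QE mxE summxE /IDFT; congr (_ * _); apply: eq_bigr => p _.
set W := _ *m cmx P.
rewrite mxE.
under eq_bigr => j _.
  rewrite !mxE; under eq_bigr do rewrite mxE.
  rewrite sum_deltal conjcMn conj_omegaXV eq_sym.
  over.
(* The exponentials of Phi_p and of its adjoint combine into omega^(-p (a - b)), the kernel of the
   IDFT at the lag. *)
by rewrite sum_deltar omegaX_sub// invf_div -mulrA [LHS]mulrC mulrA.
Qed.
End Resolvent.

(** * Perturbing one entry of the array *)

(** circ is linear in the array; the zero array perturbed by 1 serves as the unit array. *)
Lemma circZ_perturb C m (Z : arr R C T m) c t i s :
  circZ (perturb Z c t i s) =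
  circZ Z + s *: circZ (perturb (fun _ _ _ => 0) c t i 1).
Proof.
apply/matrixP => u v; rewrite !(mxE, circZE) /perturb add0r.
by case: ifP; rewrite ?mulr1 ?mulr0.
Qed.

(** The trace is the entrywise pairing of Q with a 0-1 matrix, whose T ones lie in block (c, i) at
    lag t, where Q is constant. *)
Lemma mxtrace_circZ_unit C m (Q : 'M[R]_(_, _))
    (U : 'I_C -> 'I_T -> 'I_m -> R[i]) c t i :
  (forall s u, (Q s u)%:C = U (blk s) (sub_mod (pos s) (pos u)) (blk u)) ->
  (\tr (Q *m (circZ (perturb (fun _ _ _ => 0) c t i 1))^T))%:C =
  T%:R * U c t i.
Proof.
move=> QU; rewrite rmorph_sum /=.
under eq_bigr => s _.
  rewrite mxE rmorph_sum /=.
  under eq_bigr => u _.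
    rewrite [_^T _ _]mxE circZE /perturb add0r rmorphM /= QU.
    over.
  rewrite (sum_blk_pos (fun j b => U (blk s) (sub_mod (pos s) b) j *
   (if (blk s == c) && (sub_mod (pos s) b == t) && (j == i) then 1 else 0)%:C)).
  over.
rewrite (sum_blk_pos (fun k a => \sum_j \sum_b U k (sub_mod a b) j *
   (if (k == c) && (sub_mod a b == t) && (j == i) then 1 else 0)%:C)) /=.
rewrite (bigD1 c)//= [X in _ + X]big1 ?addr0; last first.
  move=> k /negPf kc; apply: big1 => a _; apply: big1 => j _; apply: big1 => b _.
  by rewrite kc mulr0.
under eq_bigr => a _.
  rewrite (bigD1 i)//= [X in _ + X]big1 ?addr0; last first.
    move=> j /negPf ji; apply: big1 => b _.
    by rewrite ji andbF mulr0.
  over.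
rewrite exchange_big /=.
transitivity (\sum_(b < T) U c t i); last first.
  by rewrite sumr_const card_ord mulr_natl.
(* For a fixed column time b, exactly one row time a has lag a - b = t. *)
apply: eq_bigr => b _.
pose F d := U c d i * (if (c == c) && (d == t) && (i == i) then 1 else 0)%:C.
rewrite -[LHS](reindex_inj (F := F) (P := xpredT) (sub_mod_injl (b := b))) /F.
rewrite (bigD1 t)//= !eqxx mulr1 big1 ?addr0// => d /negPf dt.
by rewrite dt andbF mulr0.
Qed.
End BlockFourier.

(** * Gradients of the log-determinants *)

Lemma kron_id_diag (R : realType) (T m : nat) (P : 'M[R]_m) :
  is_diag_mx P ->
  kron_id T P = diag_mx (\row_(u < \sum_(i < m) T) P (blk u) (blk u)).
Proof.
move=> /is_diag_mxP dP; apply/matrixP => s u.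
rewrite kron_idE !mxE eq_blk_pos.
have [->|su] := eqVneq (blk s) (blk u); first by [].
by rewrite dP ?mul0rn// val_eqE.
Qed.

Lemma is_derive_logdet_C (R : realType) (C T m : nat) (Z : arr R C T m)
    (a : R) (P : 'M[R]_m) c t i :
  (0 < T)%N -> 0 < a -> is_diag_mx P -> (forall i, 0 <= P i i) ->
  exists2 d : R,
    is_derive (0 : R) 1 (fun s => logdet_C a P (perturb Z c t i s)) d &
    (d / (2 * T%:R))%:C =
      IDFT (fun p => Cbar a P Z p *m DFT Z p *m cmx P) c t i.
Proof.
move=> T0 a0 dP P0.
set M := circZ Z; set Pi := kron_id T P.
pose E := circZ (perturb (fun _ _ _ => 0 : R) c t i 1).
set G := 1%:M + a *: (M *m Pi *m M^T).
have PiT : Pi^T = Pi by rewrite /Pi kron_id_diag// tr_diag_mx.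
have GT : G^T = G.
  by rewrite /G linearD linearZ /= trmx1 !trmx_mul trmxK PiT mulmxA.
have G0 : 0 < \det G.
  rewrite /G /Pi kron_id_diag//; set r := \row_u _.
  (* The factor a is absorbed into the nonnegative diagonal. *)
  rewrite scalemxAl scalemxAr -linearZ /=.
  by apply: det_gram_gt0 => u; rewrite !mxE mulr_ge0// ltW.
have uG : G \in unitmx by rewrite unitmxE unitfE gt_eqF.
set Q := a *: (invmx G *m M *m Pi).
pose B := a *: (E *m Pi *m M^T + M *m Pi *m E^T).
(* The two terms of [B] contribute equally: one is a cyclic shift of Q E^T under the trace, the
   other becomes Q E^T after transposition, as G and Pi are symmetric. *)
have trB : \tr (B *m invmx G) = 2 * \tr (Q *m E^T).
  rewrite -scalemxAl -scalemxAl !mxtraceZ mulmxDl mxtraceD mulrCA; congr (_ * _).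
  rewrite mulr_natl mulr2n; congr (_ + _); last by rewrite mxtrace_mulC !mulmxA.
  by rewrite -mxtrace_tr !trmx_mul trmxK trmx_inv GT PiT !mulmxA.
exists (2 * \tr (Q *m E^T)).
  rewrite -trB; have := is_derive_ln_det B (a *: (E *m Pi *m E^T)) G0.
  congr is_derive; apply/funext => s.
  rewrite /logdet_C circZ_perturb -/M -/E -/Pi.
  congr (ln (\det _)); rewrite /G /B -!addrA; congr (_ + _).
  rewrite [(M + _)^T]linearD /= [(s *: E)^T]linearZ /=.
  rewrite !mulmxDl !mulmxDr -!scalemxAl -!scalemxAr.
  rewrite !scalerDr !scalerA expr2 -!addrA; congr (_ + _).
  by rewrite addrCA (mulrAC s s) (mulrC a).
(* The 2 cancels the two equal halves, and T cancels the number of ones in E. *)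
rewrite invfM mulrACA divff ?mul1r ?pnatr_eq0// rmorphM /=.
rewrite (mxtrace_circZ_unit (U := IDFT
  (fun p => Cbar a P Z p *m DFT Z p *m cmx P))); last first.
  by move=> s u; apply: resolvent_circZE.
by rewrite fmorphV rmorph_nat mulrAC divff ?mul1r// pnatr_eq0 -lt0n.
Qed.

Lemma kron_id1 (R : realType) (T m : nat) :
  kron_id T (1%:M : 'M[R]_m) = 1%:M.
Proof.
apply/matrixP => s u.
by rewrite kron_idE !mxE -mulrnA mulnb -eq_blk_pos.
Qed.

Theorem theorem3 (R : realType) (C T m k : nat) (Z : arr R C T m) (alpha : R)
  (alphaj gammaj : 'I_k -> R) (Pi : 'I_k -> 'M[R]_m) :
  (0 < T)%N -> 0 < alpha ->
  (forall j, 0 < alphaj j) ->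
  (forall j, is_diag_mx (Pi j)) ->
  (forall j (i : 'I_m), 0 <= Pi j i i) ->
  (forall (c : 'I_C) (t : 'I_T) (i : 'I_m),
     let f := fun s : R => logdet_E alpha (perturb Z c t i s) in
     derivable f 0 1 /\
     (((2 * T%:R)^-1 * derive1 f 0)%:C =
        IDFT (fun p => Ebar alpha Z p *m DFT Z p) c t i)) /\
  (forall (j : 'I_k) (c : 'I_C) (t : 'I_T) (i : 'I_m),
     let g := fun s : R => logdet_C (alphaj j) (Pi j) (perturb Z c t i s) in
     derivable g 0 1 /\
     ((gammaj j / (2 * T%:R) * derive1 g 0)%:C =
        (gammaj j)%:C *
        IDFT (fun p => (Cbar (alphaj j) (Pi j) Z p *m DFT Z p) *m cmx (Pi j))
             c t i)).
Proof.
move=> T0 a0 aj0 dP P0; split=> [c t i | j c t i] /=.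
- have d1 : is_diag_mx (1%:M : 'M[R]_m) by exact: scalar_mx_is_diag.
  have p1 l : 0 <= (1%:M : 'M[R]_m) l l by rewrite mxE eqxx.
  have [d [df dE] dC] := is_derive_logdet_C Z c t i T0 a0 d1 p1.
  have fE : (fun s => logdet_E alpha (perturb Z c t i s)) =
            (fun s => logdet_C alpha 1%:M (perturb Z c t i s)).
    by apply/funext => s; rewrite /logdet_C kron_id1 mulmx1.
  rewrite fE; split=> //; rewrite derive1E dE mulrC dC.
  congr (IDFT _ c t i); apply/funext => p.
  by rewrite /Cbar /Ebar cmxE map_mx1 !mulmx1.
- have [d [dg dE] dC] := is_derive_logdet_C Z c t i T0 (aj0 j) (dP j) (P0 j).
  by split=> //; rewrite derive1E dE -dC -mulrA [_^-1 * _]mulrC rmorphM.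
Qed.
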